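(* Let $0<\Phi<2\pi$, let $\hbar>0$, let $n_\phi\in\{1,2,3,\ldots\}$, and let $$u_{n_\phi}(\phi)=\sqrt{\tfrac{2}{\Phi}}\,\sin\!\left(\frac{n_\phi\pi\phi}{\Phi}\right),\qquad 0\le\phi\le\Phi,$$ be the $n_\phi$-th azimuthal wavefunction of the spherical wedge of azimuthal extent $\Phi$. Then $u_{n_\phi}$ is not an eigenfunction of $\hat L_z=-i\hbar\,\frac{d}{d\phi}$: there is no constant $c\in\mathbb{C}$ such that $\hat L_z u_{n_\phi}(\phi)=c\,u_{n_\phi}(\phi)$ for all $\phi\in[0,\Phi]$.
   Context: The spherical wedge of azimuthal extent $\Phi$ and radius $R>0$ is $\{(r,\theta,\phi):0\le r\le R,\ 0\le\theta\le\pi,\ 0\le\phi\le\Phi\}$ in spherical coordinates, with Dirichlet conditions imposed on its boundary. Its azimuthal wavefunctions $u_{n_\phi}$ are the $L^2([0,\Phi])$-normalised solutions of $u''+\mu^2u=0$, $u(0)=u(\Phi)=0$, which have $\mu=n_\phi\pi/\Phi$. The operator $\hat L_z=-i\hbar\,d/d\phi$ acts as a differential expression on smooth functions of $\phi$. *)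

(* Defs.v *)
(* Stdlib reals with Coquelicot (complex numbers [C], derivatives). *)
From Stdlib Require Export Reals.
From Coquelicot Require Export Coquelicot.
Open Scope R_scope.

(* Dirichlet solution sqrt(2/Phi) sin (n pi phi / Phi) on [0, Phi].  It is given
   by its formula on the whole line, which is smooth, so that its two-sided
   derivative at 0 and Phi is the one-sided derivative of the restriction to
   [0, Phi]. *)
Definition wedge_azimuthal (Phi : R) (n : nat) (phi : R) : R :=
  sqrt (2 / Phi) * sin (INR n * PI * phi / Phi).

(* Derivative of a complex-valued function of a real variable.  Coquelicot has
   no total operator for it ([C_derive] differentiates along C), hence the
   components; [RC_Derive_unique] is the agreement with [is_derive]. *)
Definition RC_Derive (f : R -> C) (x : R) : C :=
  (Derive (fun t => Re (f t)) x, Derive (fun t => Im (f t)) x).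

(* - i hbar d/dphi, as a differential expression. *)
Definition Lz (hbar : R) (f : R -> C) (phi : R) : C :=
  (- Ci * RtoC hbar * RC_Derive f phi)%C.

Lemma RC_Derive_unique (f : R -> C) (x : R) (l : C) :
  is_derive (K := R_AbsRing) (V := C_R_NormedModule) f x l ->
  RC_Derive f x = l.
Proof.
intros H.
assert (H1 : is_derive (fun t : R => Re (f t)) x (Re l)).
{ apply (filterdiff_ext_lin _ (fun y => Re (scal (V := C_R_NormedModule) y l))).
  - apply (filterdiff_comp' (V := C_R_NormedModule) f Re x _ Re H).
    apply filterdiff_linear, is_linear_fst.
  - intros y; reflexivity. }
assert (H2 : is_derive (fun t : R => Im (f t)) x (Im l)).
{ apply (filterdiff_ext_lin _ (fun y => Im (scal (V := C_R_NormedModule) y l))).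
  - apply (filterdiff_comp' (V := C_R_NormedModule) f Im x _ Im H).
    apply filterdiff_linear, is_linear_snd.
  - intros y; reflexivity. }
unfold RC_Derive.
apply is_derive_unique in H1, H2.
rewrite H1, H2.
now destruct l.
Qed.

(* Main.v *)
(** At the endpoint 0 the wavefunction vanishes but its derivative does not, so
    the eigenvalue equation already fails there, whatever the constant. *)
Require Import Defs.
From Stdlib Require Import Reals Lra Lia.
From Coquelicot Require Import Coquelicot.
Open Scope R_scope.

(** Evaluate the eigenvalue equation at [phi = 0]. The Dirichlet condition ([wedge_azimuthal_0])
    makes the right side 0 for every [c], while the left side is [-i hbar] times the slope there,
    which [is_derive_wedge_azimuthal] shows to be nonzero. *)

Lemma wedge_azimuthal_0 (Phi : R) (n : nat) : wedge_azimuthal Phi n 0 = 0.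
Proof.
unfold wedge_azimuthal, Rdiv.
now rewrite Rmult_0_r, Rmult_0_l, sin_0, Rmult_0_r.
Qed.

Lemma is_derive_wedge_azimuthal (Phi : R) (n : nat) (x : R) :
  is_derive (wedge_azimuthal Phi n) x
    (sqrt (2 / Phi) * (INR n * PI / Phi) * cos (INR n * PI * x / Phi)).
Proof.
unfold wedge_azimuthal.
auto_derive; [exact I | unfold Rdiv; ring].
Qed.

(** A real [f] has a real derivative, which the factor [-i] turns purely imaginary; this reduces the
    complex equation to one real equation. *)
Lemma Lz_RtoC (hbar : R) (f : R -> R) (x : R) :
  Lz hbar (fun t => RtoC (f t)) x = (0, - (hbar * Derive f x)).
Proof.
unfold Lz, RC_Derive; simpl.
rewrite Derive_const.
change (fun t : R => f t) with f.
unfold Ci, RtoC, Cmult, Copp; simpl.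
f_equal; ring.
Qed.

Theorem mainTheorem1 (Phi hbar : R) (n : nat)
    (hPhi0 : 0 < Phi) (hPhi2 : Phi < 2 * PI) (hhbar : 0 < hbar)
    (hn : (1 <= n)%nat) :
  ~ exists c : C, forall phi : R, 0 <= phi <= Phi ->
      Lz hbar (fun t => RtoC (wedge_azimuthal Phi n t)) phi
      = (c * RtoC (wedge_azimuthal Phi n phi))%C.
Proof.
intros [c Hc].
specialize (Hc 0 ltac:(lra)).
rewrite Lz_RtoC, wedge_azimuthal_0, Cmult_0_r in Hc.
(* The real parts agree trivially, so the contradiction must come from the imaginary parts. *)
apply (f_equal snd) in Hc; simpl in Hc.
rewrite (is_derive_unique _ _ _ (is_derive_wedge_azimuthal Phi n 0)) in Hc.
replace (INR n * PI * 0 / Phi) with 0 in Hc by (unfold Rdiv; ring).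
rewrite cos_0, Rmult_1_r in Hc.
(* [Hc] now says that [hbar] times the slope at 0 vanishes; [1 <= n] makes that slope positive. *)
assert (0 < hbar * (sqrt (2 / Phi) * (INR n * PI / Phi))); [|lra].
apply Rmult_lt_0_compat; [exact hhbar|].
apply Rmult_lt_0_compat.
- apply sqrt_lt_R0, Rdiv_lt_0_compat; lra.
- apply Rdiv_lt_0_compat; [|exact hPhi0].
  apply Rmult_lt_0_compat; [apply lt_0_INR; lia | exact PI_RGT_0].
Qed.
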